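(* Let $P$ be a polygonal knot embedded in $\mathbb{R}^3$ consisting of $n$ line segments. If $w(K)$ is the writhe of one orthogonal planar projection $K$ of $P$, then for every orthogonal planar projection $K'$ of $P$, the number $c$ of crossings of $K'$ satisfies $c \ge \frac{1}{16}\left(|w(K)| - 3n\right)$.
   Context: Orthogonal planar projections are taken in general-position directions, so that they are knot diagrams with finitely many transverse double-point crossings carrying over/under information. The writhe $w(K)$ of a diagram is computed by orienting it and assigning to each crossing the sign $+1$ if the oriented undercrossing strand is oriented by the right-hand rule relative to the oriented overcrossing strand and $-1$ otherwise, then summing over all crossings; it is independent of the chosen orientation. *)

(* Defs.v *)
From HB Require Import structures.
From mathcomp Require Import all_boot all_order all_algebra.
From mathcomp Require Import boolp reals.
Set Implicit Arguments. Unset Strict Implicit. Unset Printing Implicit Defensive.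
Import Order.TTheory GRing.Theory Num.Theory.
Local Open Scope ring_scope.

Section Geometry.
Variable R : realType.

Record pt3 := P3 { px : R; py : R; pz : R }.

Definition vadd (a b : pt3) := P3 (px a + px b) (py a + py b) (pz a + pz b).
Definition vsub (a b : pt3) := P3 (px a - px b) (py a - py b) (pz a - pz b).
Definition vscale (k : R) (a : pt3) := P3 (k * px a) (k * py a) (k * pz a).
Definition vzero := P3 0 0 0.
Definition dot (a b : pt3) := px a * px b + py a * py b + pz a * pz b.
Definition cross (a b : pt3) :=
  P3 (py a * pz b - pz a * py b) (pz a * px b - px a * pz b)
     (px a * py b - py a * px b).
Definition det3 (a b c : pt3) := dot (cross a b) c.

(* A closed polygon with n vertices v 0, ..., v (n-1); segment i goes from
   v i to v ((i+1) mod n). *)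
Definition seg_dir (n : nat) (v : nat -> pt3) (i : nat) :=
  vsub (v (i.+1 %% n)%N) (v i).
Definition seg_pt (n : nat) (v : nat -> pt3) (i : nat) (s : R) :=
  vadd (v i) (vscale s (seg_dir n v i)).

Definition adjacent_at (n : nat) (i j : nat) (s t : R) : Prop :=
  (j = (i.+1 %% n)%N /\ s = 1 /\ t = 0) \/ (i = (j.+1 %% n)%N /\ s = 0 /\ t = 1).

Definition in01 (s : R) := 0 <= s <= 1.

Definition polygonal_knot (n : nat) (v : nat -> pt3) : Prop :=
  [/\ (3 <= n)%N,
      (forall i, (i < n)%N -> v i <> v (i.+1 %% n)%N) &
      (forall i j s t, (i < n)%N -> (j < n)%N -> i <> j -> in01 s -> in01 t ->
         seg_pt n v i s = seg_pt n v j t -> adjacent_at n i j s t)].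

(* orthogonal projection along the nonzero direction u: p and q have the same
   image iff p - q is parallel to u *)
Definition same_proj (u p q : pt3) := cross (vsub p q) u = vzero.

Definition proj_meet n v (u : pt3) i j (s t : R) :=
  [/\ in01 s, in01 t & same_proj u (seg_pt n v i s) (seg_pt n v j t)].

(* the projection along u is in general position: a knot diagram whose only
   singularities are finitely many transverse double points *)
Definition general_position (n : nat) (v : nat -> pt3) (u : pt3) : Prop :=
  [/\ u <> vzero,
      (forall i, (i < n)%N -> cross (seg_dir n v i) u <> vzero),
      (forall i j s t, (i < n)%N -> (j < n)%N -> i <> j -> proj_meet n v u i j s t ->
         adjacent_at n i j s t \/
         [/\ 0 < s < 1, 0 < t < 1 & det3 (seg_dir n v i) (seg_dir n v j) u != 0]) &
      (forall i j k s t r, (i < n)%N -> (j < n)%N -> (k < n)%N ->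
         i <> j -> i <> k -> j <> k ->
         proj_meet n v u i j s t -> proj_meet n v u i k s r ->
         adjacent_at n i j s t \/ adjacent_at n i k s r)].

Definition is_crossing n v u i j : Prop :=
  exists s t, proj_meet n v u i j s t /\ ~ adjacent_at n i j s t.

(* height along the viewing direction u (larger height = over strand) *)
Definition height (u p : pt3) := dot p u.

(* crossing of segments i,j with sign +1 (resp. -1): det(over, under, u) > 0
   (resp. < 0), the right-hand rule for oriented strands viewed from +u. *)
Definition pos_crossing n v u i j : Prop :=
  exists s t, [/\ proj_meet n v u i j s t, ~ adjacent_at n i j s t &
    (height u (seg_pt n v i s) > height u (seg_pt n v j t) /\
       det3 (seg_dir n v i) (seg_dir n v j) u > 0) \/
    (height u (seg_pt n v j t) > height u (seg_pt n v i s) /\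
       det3 (seg_dir n v j) (seg_dir n v i) u > 0)].

Definition neg_crossing n v u i j : Prop :=
  exists s t, [/\ proj_meet n v u i j s t, ~ adjacent_at n i j s t &
    (height u (seg_pt n v i s) > height u (seg_pt n v j t) /\
       det3 (seg_dir n v i) (seg_dir n v j) u < 0) \/
    (height u (seg_pt n v j t) > height u (seg_pt n v i s) /\
       det3 (seg_dir n v j) (seg_dir n v i) u < 0)].

Definition crossings n v u : nat :=
  (\sum_(i < n) \sum_(j < n | (i < j)%N) asbool (is_crossing n v u i j))%N.

Definition writhe n v u : int :=
  \sum_(i < n) \sum_(j < n | (i < j)%N)
     ((asbool (pos_crossing n v u i j))%:Z - (asbool (neg_crossing n v u i j))%:Z).

End Geometry.

(* Main.v *)
(* For non-adjacent edges i, j the differences g_j(t) - g_i(s) fill a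
   parallelogram missing the origin, and a crossing of i and j in the projection
   along u is a hit of the ray of direction u on the parallelogram of (i, j) or
   of (j, i), with the right sign; so the writhe along u is the signed count of
   hits on all parallelograms.  Between two directions u and u' the count for
   one parallelogram changes by the signed number of its sides meeting the open
   cone spanned by u and u'.  The parallelograms tile the torus (Z/n)^2 minus a
   neighbourhood of the diagonal, so the contributions of inner sides cancel, and
   the two boundary curves, running through e_i, e_i + e_(i+1), e_(i+1), ... and
   through the opposite vectors, contribute at most n each.  Hence
   |w(u) - w(u')| <= 2n, while |w(u')| is at most the number of crossings along
   u'.  The count is unchanged under small perturbations of a direction in
   general position, which makes all determinants involved nonzero. *)
Require Import Defs.
From HB Require Import structures.
From mathcomp Require Import all_boot all_order all_algebra.
From mathcomp Require Import boolp reals.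
From mathcomp Require Import ring lra zify.
Set Implicit Arguments.
Unset Strict Implicit.
Unset Printing Implicit Defensive.
Import Order.TTheory GRing.Theory Num.Theory.
Local Open Scope ring_scope.

(** * Sign patterns of determinants at triangles and their sides *)

Section SignedCounts.
Variable R : realType.
Implicit Types (a b c d e f u w p q : pt3 R) (x y z s t l : R).

Lemma pt3_eq p q : px p = px q -> py p = py q -> pz p = pz q -> p = q.
Proof. by case: p => ? ? ?; case: q => ? ? ? /= -> -> ->. Qed.

(* Here [a3] stands for [det3 u u' a], [m] for [det3 a b u] and [n] for
   [det3 a b u']: the point of the segment [a, b] in the plane of u and u' is,
   up to a positive factor, [m u' - n u] if [a3 < 0 < b3] and its opposite if
   [b3 < 0 < a3]. *)
Definition arc_cond (a3 b3 m n : R) : int :=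
  ([&& a3 < 0, 0 < b3, 0 < m & n < 0])%:Z
  - ([&& b3 < 0, 0 < a3, m < 0 & 0 < n])%:Z.

(* By Cramer, [d u = m2 a + m3 b + m1 c] when [d = det3 a b c] and the [m]'s are
   [det3 a b u], [det3 b c u], [det3 c a u]. *)
Definition tri_cond (d m1 m2 m3 : R) : int :=
  ([&& 0 < d, 0 < m1, 0 < m2 & 0 < m3])%:Z
  - ([&& d < 0, m1 < 0, m2 < 0 & m3 < 0])%:Z.

(* Parallel points [a], [b] must lie on the same side of the origin. *)
Definition pair_ok (d a3 b3 m n : R) :=
  [/\ m = 0, n = 0, d = 0 & 0 < a3 * b3] \/ (m != 0 /\ n != 0).

(** Numbers of one weak sign must all vanish: the bound on their sum forces it. *)
Definition no_sign (m1 m2 m3 : R) :=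
  (0 <= m1 -> 0 <= m2 -> 0 <= m3 -> m1 + m2 + m3 <= 0) /\
  (m1 <= 0 -> m2 <= 0 -> m3 <= 0 -> 0 <= m1 + m2 + m3).

(** Only the sides [[b, c]] and [[c, a]] cross the plane of [u] and [u']. The third relation rules
    out the sign patterns that do not fit the sign of [d]. *)
Lemma tri_cond_mixed (a3 b3 c3 d mab mbc mca nab nbc nca : R) :
  0 < a3 -> 0 < b3 -> c3 < 0 ->
  a3 * mbc + b3 * mca + c3 * mab = 0 ->
  a3 * nbc + b3 * nca + c3 * nab = 0 ->
  nca * mbc - nbc * mca = d * c3 ->
  pair_ok d b3 c3 mbc nbc -> pair_ok d c3 a3 mca nca ->
  (d = 0 -> no_sign mab mbc mca) -> (d = 0 -> no_sign nab nbc nca) ->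
  tri_cond d mab mbc mca - tri_cond d nab nbc nca =
  arc_cond a3 b3 mab nab + arc_cond b3 c3 mbc nbc + arc_cond c3 a3 mca nca.
Proof.
move=> ha hb hc hM hN hd.
(* A parallel pair would need [0 < b3 * c3], against the signs at hand. *)
case=> [[_ _ _]|[hmbc hnbc]]; first by rewrite pmulr_rgt0 // (lt_gtF hc).
case=> [[_ _ _]|[hmca hnca]]; first by rewrite pmulr_lgt0 // (lt_gtF hc).
move=> h1 h2.
(* Since [- c3 * mab] is a positive combination of [mbc] and [mca], these decide the sign of [mab]
   whenever they agree. *)
have pM : 0 < mbc -> 0 < mca -> 0 < mab by move=> ? ?; nra.
have nM : mbc < 0 -> mca < 0 -> mab < 0 by move=> ? ?; nra.
have pN : 0 < nbc -> 0 < nca -> 0 < nab by move=> ? ?; nra.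
have nN : nbc < 0 -> nca < 0 -> nab < 0 by move=> ? ?; nra.
rewrite /arc_cond /tri_cond ha hb hc (lt_gtF ha) (lt_gtF hb) (lt_gtF hc) /=.
case: (ltrgtP d 0) hd h1 h2 => [d0|d0|->] hd.
all: move=> h1 h2.
all: case: (ltrgtP mbc 0) hmbc pM nM hd h1 => //= sbc _ pM nM hd h1.
all: case: (ltrgtP mca 0) hmca pM nM hd h1 => //= sca _ pM nM hd h1.
all: case: (ltrgtP nbc 0) hnbc pN nN hd h2 => //= tbc _ pN nN hd h2.
all: case: (ltrgtP nca 0) hnca pN nN hd h2 => //= tca _ pN nN hd h2.
all: rewrite ?andbF ?andbT //=.
all: rewrite ?(pM isT isT) ?(nM isT isT) ?(pN isT isT) ?(nN isT isT) ?andbF ?andbT //=.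
all: exfalso.
all: try (move: hd; nra).
all: try (have [h _] := h1 erefl; have := pM isT isT; lra).
all: try (have [_ h] := h1 erefl; have := nM isT isT; lra).
all: try (have [h _] := h2 erefl; have := pN isT isT; lra).
all: try (have [_ h] := h2 erefl; have := nN isT isT; lra).
Qed.

Lemma pair_okN (d a3 b3 m n : R) :
  pair_ok d a3 b3 m n -> pair_ok (- d) (- a3) (- b3) (- m) (- n).
Proof.
rewrite /pair_ok !oppr_eq0 mulrNN; case=> [[-> -> -> ->]|]; last by right.
by left; rewrite oppr0.
Qed.

Lemma no_signN (m1 m2 m3 : R) : no_sign m1 m2 m3 -> no_sign (- m1) (- m2) (- m3).
Proof. by move=> [h1 h2]; split=> ? ? ?; lra. Qed.

Lemma no_sign_rot (m1 m2 m3 : R) : no_sign m1 m2 m3 -> no_sign m2 m3 m1.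
Proof. by move=> [h1 h2]; split=> ? ? ?; lra. Qed.

Lemma arc_condN (a3 b3 m n : R) :
  arc_cond (- a3) (- b3) (- m) (- n) = - arc_cond a3 b3 m n.
Proof.
rewrite /arc_cond !oppr_lt0 !oppr_gt0 opprB.
by congr (Posz (nat_of_bool _) - Posz (nat_of_bool _)); rewrite andbCA.
Qed.

Lemma tri_condN (d m1 m2 m3 : R) :
  tri_cond (- d) (- m1) (- m2) (- m3) = - tri_cond d m1 m2 m3.
Proof. by rewrite /tri_cond !oppr_lt0 !oppr_gt0 opprB. Qed.

Lemma tri_cond_rot (d m1 m2 m3 : R) : tri_cond d m1 m2 m3 = tri_cond d m2 m3 m1.
Proof.
by rewrite /tri_cond [(0 < m1) && _]andbC [(m1 < 0) && _]andbC -!andbA.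
Qed.

(** The relation puts the direction into a plane through the origin with the whole triangle strictly
    on one side, so it cannot lie in the open cone. *)
Lemma tri_cond_same (a3 b3 c3 d m1 m2 m3 : R) :
  0 < a3 -> 0 < b3 -> 0 < c3 -> a3 * m2 + b3 * m3 + c3 * m1 = 0 ->
  tri_cond d m1 m2 m3 = 0.
Proof.
move=> ha hb hc h; rewrite /tri_cond.
case: (ltrgtP m1 0) => h1; rewrite ?andbF //=.
all: case: (ltrgtP m2 0) => h2; rewrite ?andbF //=.
all: case: (ltrgtP m3 0) => h3; rewrite ?andbF //=.
all: by exfalso; nra.
Qed.

Lemma tri_cond_arcs (a3 b3 c3 d mab mbc mca nab nbc nca : R) :
  a3 != 0 -> b3 != 0 -> c3 != 0 ->
  a3 * mbc + b3 * mca + c3 * mab = 0 ->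
  a3 * nbc + b3 * nca + c3 * nab = 0 ->
  nca * mbc - nbc * mca = d * c3 ->
  nab * mca - nca * mab = d * a3 ->
  nbc * mab - nab * mbc = d * b3 ->
  pair_ok d a3 b3 mab nab -> pair_ok d b3 c3 mbc nbc -> pair_ok d c3 a3 mca nca ->
  (d = 0 -> no_sign mab mbc mca) -> (d = 0 -> no_sign nab nbc nca) ->
  tri_cond d mab mbc mca - tri_cond d nab nbc nca =
  arc_cond a3 b3 mab nab + arc_cond b3 c3 mbc nbc + arc_cond c3 a3 mca nca.
Proof.
(* Two of three nonzero values share a sign. If it is negative, negating all data changes the sign
   of both sides of the claim. *)
wlog two_pos : a3 b3 c3 d mab mbc mca nab nbc nca /
    [|| (0 < a3) && (0 < b3), (0 < b3) && (0 < c3) | (0 < c3) && (0 < a3)].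
  move=> W a0 b0 c0 hM hN hc ha hb oab obc oca sM sN.
  have [p|np] := boolP [|| (0 < a3) && (0 < b3), (0 < b3) && (0 < c3)
      | (0 < c3) && (0 < a3)]; first exact: W.
  have E : tri_cond (- d) (- mab) (- mbc) (- mca) - tri_cond (- d) (- nab) (- nbc) (- nca)
      = arc_cond (- a3) (- b3) (- mab) (- nab) + arc_cond (- b3) (- c3) (- mbc) (- nbc)
        + arc_cond (- c3) (- a3) (- mca) (- nca).
    apply: W; rewrite ?oppr_eq0 //; try exact: pair_okN; try lra.
    - by move=> /eqP; rewrite oppr_eq0 => /eqP/sM/no_signN.
    - by move=> /eqP; rewrite oppr_eq0 => /eqP/sN/no_signN.
  by move: E; rewrite !arc_condN !tri_condN; lia.
move=> a0 b0 c0 hM hN hc ha hb oab obc oca sM sN.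
(* Rotation brings the single negative value, if any, to the last place. *)
have [a3n|a3p|/eqP] := ltrgtP a3 0; last by rewrite (negPf a0).
- move: two_pos; rewrite (lt_gtF a3n) andbF orbF /= => /andP[b3p c3p].
  rewrite tri_cond_rot (tri_cond_rot d nab) -[RHS]addrA [RHS]addrC.
  apply: tri_cond_mixed => //; try lra; first by move=> /sM/no_sign_rot.
  by move=> /sN/no_sign_rot.
have [b3n|b3p|/eqP] := ltrgtP b3 0; last by rewrite (negPf b0).
- move: two_pos; rewrite (lt_gtF b3n) andbF /= => /andP[c3p _].
  rewrite -(tri_cond_rot d mca) -(tri_cond_rot d nca) [RHS]addrC [RHS]addrA.
  apply: tri_cond_mixed => //; try lra; first by move=> /sM/no_sign_rot/no_sign_rot.
  by move=> /sN/no_sign_rot/no_sign_rot.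
have [c3n|c3p|/eqP] := ltrgtP c3 0; last by rewrite (negPf c0).
- exact: tri_cond_mixed.
rewrite !(@tri_cond_same a3 b3 c3) // /arc_cond.
by rewrite !(lt_gtF a3p) !(lt_gtF b3p) !(lt_gtF c3p).
Qed.

(** * Hits of a direction on triangles *)

Definition arc_hit u u' a b : int :=
  arc_cond (det3 u u' a) (det3 u u' b) (det3 a b u) (det3 a b u').

Definition tri_hit u a b c : int :=
  tri_cond (det3 a b c) (det3 a b u) (det3 b c u) (det3 c a u).

Lemma cross_eq0_det a b u : cross a b = vzero R -> det3 a b u = 0.
Proof. by rewrite /det3 => ->; rewrite /dot /=; ring. Qed.

Lemma arc_anti u u' a b : arc_hit u u' b a = - arc_hit u u' a b.
Proof.
rewrite /arc_hit /arc_cond.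
have -> : det3 b a u = - det3 a b u by rewrite /det3 /dot /=; ring.
have -> : det3 b a u' = - det3 a b u' by rewrite /det3 /dot /=; ring.
by rewrite !oppr_lt0 !oppr_gt0 opprB.
Qed.

Definition in_general u u' a b :=
  cross a b <> vzero R -> det3 a b u != 0 /\ det3 a b u' != 0.

(** Equivalently, the closed triangle with vertices [a], [b], [c] misses the origin. *)
Definition cone_pointed a b c := forall x y z, 0 <= x -> 0 <= y -> 0 <= z -> 0 < x + y + z ->
  vadd (vscale x a) (vadd (vscale y b) (vscale z c)) <> vzero R.

Lemma cone_pointed_rot a b c : cone_pointed a b c -> cone_pointed b c a.
Proof.
move=> h x y z x0 y0 z0 xyz e; apply: (h z x y) => //; first by lra.
by rewrite -e; apply: pt3_eq => /=; ring.
Qed.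

Lemma opposite_signs (x y : R) : x != 0 -> y != 0 -> x * y <= 0 ->
  (x < 0) && (0 < y) || (0 < x) && (y < 0).
Proof.
case: (ltrgtP x 0) => //= sx _; case: (ltrgtP y 0) => //= sy _ h; exfalso; nra.
Qed.

Lemma pair_ok_of u u' a b c :
  det3 u u' a != 0 -> det3 u u' b != 0 ->
  in_general u u' a b -> cone_pointed a b c ->
  pair_ok (det3 a b c) (det3 u u' a) (det3 u u' b) (det3 a b u) (det3 a b u').
Proof.
move=> a0 b0 gen pointed; have [e|ne] := pselect (cross a b = vzero R); last first.
  by right; apply: gen.
left; split; try exact: cross_eq0_det.
(* For parallel [a] and [b], expanding [cross (cross u u') (cross a b)] yields a vanishing
   combination of them; opposite signs of the determinants would give both coefficients one sign. *)
have key : vsub (vscale (det3 u u' b) a) (vscale (det3 u u' a) b) = vzero R.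
  have -> : vsub (vscale (det3 u u' b) a) (vscale (det3 u u' a) b)
      = cross (cross u u') (cross a b).
    by apply: pt3_eq; rewrite /det3 /dot /=; ring.
  by rewrite e; apply: pt3_eq => /=; ring.
rewrite ltNge; apply/negP => hle.
have := opposite_signs a0 b0 hle.
case/orP => /andP[sa sb].
- apply: (pointed (det3 u u' b) (- det3 u u' a) 0); [lra|lra|lra|lra|].
  by rewrite -key; apply: pt3_eq => /=; ring.
- apply: (pointed (- det3 u u' b) (det3 u u' a) 0); [lra|lra|lra|lra|].
  have -> : vzero R = vscale (-1) (vzero R) by apply: pt3_eq => /=; ring.
  by rewrite -key; apply: pt3_eq => /=; ring.
Qed.

Lemma no_sign_of u a b c :
  cone_pointed a b c -> det3 a b c = 0 ->
  no_sign (det3 a b u) (det3 b c u) (det3 c a u).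
Proof.
move=> pointed d0.
(* Cramer's rule with zero determinant: the three values are the coefficients of a vanishing
   combination. *)
have key : vadd (vscale (det3 b c u) a) (vadd (vscale (det3 c a u) b)
    (vscale (det3 a b u) c)) = vzero R.
  have -> : vzero R = vscale (det3 a b c) u by rewrite d0; apply: pt3_eq => /=; ring.
  by apply: pt3_eq; rewrite /det3 /dot /=; ring.
split=> h1 h2 h3; rewrite leNgt; apply/negP => h.
  by apply: (pointed (det3 b c u) (det3 c a u) (det3 a b u)) => //; lra.
apply: (pointed (- det3 b c u) (- det3 c a u) (- det3 a b u)); [lra|lra|lra|lra|].
have -> : vzero R = vscale (-1) (vzero R) by apply: pt3_eq => /=; ring.
by rewrite -key; apply: pt3_eq => /=; ring.
Qed.

(** A discrete Stokes formula. The relations required come from Cramer's rule and from identities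
    such as [cross (cross b c) (cross c a) = vscale (det3 a b c) c], paired with [cross u u']. *)
Lemma tri_boundary u u' a b c :
  det3 u u' a != 0 -> det3 u u' b != 0 -> det3 u u' c != 0 ->
  in_general u u' a b -> in_general u u' b c -> in_general u u' c a ->
  cone_pointed a b c ->
  tri_hit u a b c - tri_hit u' a b c = arc_hit u u' a b + arc_hit u u' b c + arc_hit u u' c a.
Proof.
move=> a0 b0 c0 gab gbc gca p0.
have p1 := cone_pointed_rot p0; have p2 := cone_pointed_rot p1.
have dbc : det3 b c a = det3 a b c by rewrite /det3 /dot /=; ring.
have dca : det3 c a b = det3 a b c by rewrite /det3 /dot /=; ring.
apply: tri_cond_arcs => //; try by rewrite /det3 /dot /=; ring.
- exact: pair_ok_of.
- by rewrite -dbc; apply: pair_ok_of.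
- by rewrite -dca; apply: pair_ok_of.
- exact: no_sign_of.
- exact: no_sign_of.
Qed.

(** * Hits of a direction on parallelograms *)

Definition pos4 (m1 m2 m3 m4 : R) := [&& 0 < m1, 0 < m2, 0 < m3 & 0 < m4].

Definition quad_cond (d m1 m2 m3 m4 : R) : int :=
  ((0 < d) && pos4 m1 m2 m3 m4)%:Z
  - ((d < 0) && pos4 (- m1) (- m2) (- m3) (- m4))%:Z.

Definition cell_hit u a b c d : int :=
  quad_cond (det3 a b c) (det3 a b u) (det3 b c u) (det3 c d u) (det3 d a u).

(** [k] stands for the determinant of the diagonal [[a, c]] with the direction. Its sign selects the
    triangle that can be hit, and the two relations then supply the conditions at the other two
    sides. *)
Lemma quad_cond_split (d m1 m2 m3 m4 k : R) :
  k = m1 - m4 -> k = m2 - m3 -> (k = 0 -> d = 0) ->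
  quad_cond d m1 m2 m3 m4 = tri_cond d m1 m2 (- k) + tri_cond d k m3 m4.
Proof.
move=> e1 e2 h; rewrite /quad_cond /tri_cond /pos4 !oppr_gt0 oppr_lt0.
case: (ltrgtP d 0) h => h0 h //=.
all: have {h} : k != 0 by apply/eqP => /h; lra.
all: case: (ltrgtP k 0) => //= k0 _; rewrite ?andbF ?andbT ?subr0 ?add0r ?addr0 //=.
all: try congr (- _); congr (Posz (nat_of_bool _)); apply/idP/idP; lra.
Qed.

Lemma in_general_sym u u' a b : in_general u u' a b -> in_general u u' b a.
Proof.
move=> h ne; have [] : det3 a b u != 0 /\ det3 a b u' != 0.
  apply: h => e; apply: ne.
  have -> : cross b a = vscale (-1) (cross a b) by apply: pt3_eq => /=; ring.
  by rewrite e; apply: pt3_eq => /=; ring.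
have -> : det3 b a u = - det3 a b u by rewrite /det3 /dot /=; ring.
have -> : det3 b a u' = - det3 a b u' by rewrite /det3 /dot /=; ring.
by rewrite !oppr_eq0.
Qed.

Lemma cell_boundary u u' a b c d :
  vadd a c = vadd b d ->
  (forall s t, in01 s -> in01 t ->
     vadd a (vadd (vscale s (vsub b a)) (vscale t (vsub d a))) <> vzero R) ->
  det3 u u' a != 0 -> det3 u u' b != 0 -> det3 u u' c != 0 -> det3 u u' d != 0 ->
  in_general u u' a b -> in_general u u' b c -> in_general u u' c d ->
  in_general u u' d a -> in_general u u' a c ->
  cell_hit u a b c d - cell_hit u' a b c d =
  arc_hit u u' a b + arc_hit u u' b c + arc_hit u u' c d + arc_hit u u' d a.
Proof.
move=> sides miss a0 b0 c0 d0 gab gbc gcd gda gac.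
have ed : d = vsub (vadd a c) b.
  by rewrite sides; apply: pt3_eq => /=; ring.
(* A vanishing determinant at the diagonal means that [a] and [c] are parallel, so the parallelogram
   lies in a plane through the origin. *)
have diag0 w : (cross a c <> vzero R -> det3 a c w != 0) -> det3 a c w = 0 -> det3 a b c = 0.
  move=> h e; have [ac0|/h] := pselect (cross a c = vzero R); last by rewrite e eqxx.
  have -> : det3 a b c = - det3 a c b by rewrite /det3 /dot /=; ring.
  by rewrite cross_eq0_det // oppr0.
have split_cell w : (cross a c <> vzero R -> det3 a c w != 0) ->
    cell_hit w a b c d = tri_hit w a b c + tri_hit w a c d.
  move=> h; rewrite /cell_hit /tri_hit.
  have -> : det3 a c d = det3 a b c by rewrite ed /det3 /dot /=; ring.
  have -> : det3 c a w = - det3 a c w by rewrite /det3 /dot /=; ring.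
  apply: quad_cond_split; last exact: diag0.
  - by rewrite ed /det3 /dot /=; ring.
  - by rewrite ed /det3 /dot /=; ring.
have miss1 : cone_pointed a b c.
  move=> x y z x0 y0 z0 pos e; have pos0 : x + y + z != 0 by rewrite gt_eqF.
  (* Coordinates of the weighted mean of [a], [b], [c], as [c - a = (b - a) + (d - a)]. *)
  apply: (miss ((y + z) / (x + y + z)) (z / (x + y + z))).
  - by rewrite /in01 divr_ge0 ?ler_pdivrMr //=; lra.
  - by rewrite /in01 divr_ge0 ?ler_pdivrMr //=; lra.
  have -> : vzero R = vscale (x + y + z)^-1 (vzero R) by apply: pt3_eq => /=; ring.
  by rewrite -e ed; apply: pt3_eq => /=; field.
have miss2 : cone_pointed a c d.
  move=> x y z x0 y0 z0 pos e; have pos0 : x + y + z != 0 by rewrite gt_eqF.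
  apply: (miss (y / (x + y + z)) ((y + z) / (x + y + z))).
  - by rewrite /in01 divr_ge0 ?ler_pdivrMr //=; lra.
  - by rewrite /in01 divr_ge0 ?ler_pdivrMr //=; lra.
  have -> : vzero R = vscale (x + y + z)^-1 (vzero R) by apply: pt3_eq => /=; ring.
  by rewrite -e ed; apply: pt3_eq => /=; field.
have gca := in_general_sym gac.
rewrite !split_cell; try by move=> /gac[].
have E1 := tri_boundary a0 b0 c0 gab gbc gca miss1.
have E2 := tri_boundary a0 c0 d0 gac gcd gda miss2.
by move: E1 E2; rewrite (arc_anti u u' a c); lia.
Qed.

(** A perturbation keeps strict signs but may move a zero either way; the last hypothesis excludes
    zeros among nonnegative values. *)
Lemma pos4_stable (m1 m2 m3 m4 k1 k2 k3 k4 : R) :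
  (m1 != 0 -> Num.sg k1 = Num.sg m1) -> (m2 != 0 -> Num.sg k2 = Num.sg m2) ->
  (m3 != 0 -> Num.sg k3 = Num.sg m3) -> (m4 != 0 -> Num.sg k4 = Num.sg m4) ->
  (0 <= m1 -> 0 <= m2 -> 0 <= m3 -> 0 <= m4 -> pos4 m1 m2 m3 m4) ->
  pos4 k1 k2 k3 k4 = pos4 m1 m2 m3 m4.
Proof.
have fwd (k m : R) : (m != 0 -> Num.sg k = Num.sg m) -> 0 < m -> 0 < k.
  by move=> h m0; rewrite -sgr_gt0 h ?sgr_gt0 // gt_eqF.
have bwd (k m : R) : (m != 0 -> Num.sg k = Num.sg m) -> 0 < k -> 0 <= m.
  move=> h k0; rewrite leNgt; apply/negP => m0.
  by move: k0; rewrite -sgr_gt0 h ?sgr_gt0 ?lt_eqF // (lt_gtF m0).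
move=> h1 h2 h3 h4 strict; apply/idP/idP => /and4P[p1 p2 p3 p4].
  by apply: strict; [exact: bwd p1|exact: bwd p2|exact: bwd p3|exact: bwd p4].
by apply/and4P; split; [exact: fwd p1|exact: fwd p2|exact: fwd p3|exact: fwd p4].
Qed.

(** In use, [m1 + m3] is the determinant of two edge directions with [u], and the quotients are the
    parameters at which the projected edges meet; the last hypothesis keeps them off the ends. *)
Lemma quad_cond_stable (d m1 m2 m3 m4 k1 k2 k3 k4 : R) :
  (m1 != 0 -> Num.sg k1 = Num.sg m1) -> (m2 != 0 -> Num.sg k2 = Num.sg m2) ->
  (m3 != 0 -> Num.sg k3 = Num.sg m3) -> (m4 != 0 -> Num.sg k4 = Num.sg m4) ->
  m1 + m3 = m2 + m4 -> (m1 = 0 -> m4 = 0 -> m1 + m3 = 0 -> d = 0) ->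
  (m1 + m3 != 0 -> in01 (m4 / (m1 + m3)) -> in01 (m1 / (m1 + m3)) ->
     0 < m4 / (m1 + m3) < 1 /\ 0 < m1 / (m1 + m3) < 1) ->
  quad_cond d k1 k2 k3 k4 = quad_cond d m1 m2 m3 m4.
Proof.
move=> h1 h2 h3 h4 e hd meet.
have [->|d0] := eqVneq d 0; first by rewrite /quad_cond ltxx.
have N (k m : R) : (m != 0 -> Num.sg k = Num.sg m) -> (- m != 0 -> Num.sg (- k) = Num.sg (- m)).
  by rewrite oppr_eq0 !sgrN => h /h ->.
rewrite /quad_cond; congr (Posz (nat_of_bool (_ && _)) - Posz (nat_of_bool (_ && _))).
  apply: pos4_stable => // p1 p2 p3 p4.
  have D0 : 0 < m1 + m3.
    rewrite lt_neqAle addr_ge0 // andbT eq_sym; apply: contra_neqN d0 => /eqP D0.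
    by apply: hd; lra.
  have [] := meet (lt0r_neq0 D0).
  - by rewrite /in01 ler_pdivlMr ?ler_pdivrMr //; lra.
  - by rewrite /in01 ler_pdivlMr ?ler_pdivrMr //; lra.
  rewrite !ltr_pdivlMr ?ltr_pdivrMr // /pos4; lra.
apply: pos4_stable => //; try exact: N; rewrite !oppr_ge0 => p1 p2 p3 p4.
have D0 : m1 + m3 < 0.
  rewrite lt_neqAle; apply/andP; split; last by lra.
  by apply: contra_neqN d0 => /eqP D0; apply: hd; lra.
have [] := meet (ltr0_neq0 D0).
- by rewrite /in01 ler_ndivlMr ?ler_ndivrMr //; lra.
- by rewrite /in01 ler_ndivlMr ?ler_ndivrMr //; lra.
rewrite !ltr_ndivlMr ?ltr_ndivrMr // /pos4; lra.
Qed.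

Lemma cramer a e f u :
  vsub (vsub (vscale (det3 f e u) a) (vscale (det3 f a u) e)) (vscale (det3 a e u) f)
  = vscale (det3 a f e) u.
Proof. by apply: pt3_eq; rewrite /det3 /dot /=; ring. Qed.

End SignedCounts.

(** * Crossings of two edges as hits on their parallelogram *)

Section Polygon.
Variable R : realType.
Implicit Types (a b c d e f u w p q : pt3 R) (x y z s t l : R).

Lemma dotuu_gt0 u : u <> vzero R -> 0 < dot u u.
Proof.
case: u => x y z ne; rewrite /dot /= lt_neqAle; apply/andP; split; last by nra.
apply/eqP => e; apply: ne; apply: pt3_eq => /=; nra.
Qed.

(** The vector [g] is [s e - t f - a]; each equality results from pairing the zero vector
    [cross g u] with [e], [f] or [u] and the edges. *)
Lemma meeting_values p q e f u s t :
  let: g := vsub (vadd p (vscale s e)) (vadd q (vscale t f)) in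
  let: a := vsub q p in
  cross g u = vzero R ->
  [/\ - det3 a e u = t * det3 f e u, det3 f a u = s * det3 f e u &
      dot u u * det3 a f e = - dot g u * det3 f e u].
Proof.
set g := vsub _ _ => gu; split.
- suff: - det3 (vsub q p) e u - t * det3 f e u = - dot (cross g u) e.
    by rewrite gu /dot /=; lra.
  by rewrite /g /det3 /dot /=; ring.
- suff: det3 f (vsub q p) u - s * det3 f e u = - dot (cross g u) f.
    by rewrite gu /dot /=; lra.
  by rewrite /g /det3 /dot /=; ring.
- suff: dot u u * det3 (vsub q p) f e + dot g u * det3 f e u = - det3 (cross u (cross g u)) f e.
    by rewrite gu /det3 /dot /=; lra.
  by rewrite /g /det3 /dot /=; ring.
Qed.

(** Cramer's rule divided by [D], at the parameters forced by [meeting_values]. The sign of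
    [det3 a f e / D] decides which edge is on top. *)
Lemma meeting_exists p q e f u (a := vsub q p) (D := det3 f e u) :
  D != 0 ->
  vsub (vadd p (vscale (det3 f a u / D) e)) (vadd q (vscale (- det3 a e u / D) f))
  = vscale (- (det3 a f e / D)) u.
Proof.
move=> D0.
have -> : vscale (- (det3 a f e / D)) u = vscale (- D^-1) (vscale (det3 a f e) u).
  by apply: pt3_eq => /=; ring.
by rewrite -cramer -/D; apply: pt3_eq; rewrite /= -/a; field.
Qed.

(** If [D = det3 f e u] is nonzero and the projected lines meet at parameters [s] and [t], the
    entries are [t D], [(1 - s) D], [(1 - t) D], [s D]; they share a strict sign exactly when the
    meeting point is interior to both edges. *)
Lemma cell_hitE u a e f :
  cell_hit u a (vsub a e) (vsub (vadd a f) e) (vadd a f) =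
  quad_cond (det3 a f e) (- det3 a e u) (det3 f e u - det3 f a u)
    (det3 f e u + det3 a e u) (det3 f a u).
Proof. by rewrite /cell_hit; congr quad_cond; rewrite /det3 /dot /=; ring. Qed.

Variables (n : nat) (v : nat -> pt3 R).

Definition vertex (k : nat) := v (k %% n).

(** The ray of [u] detects only crossings with edge [j] above edge [i]. *)
Definition pair_hit u (i j : nat) : int :=
  cell_hit u (vsub (vertex j) (vertex i)) (vsub (vertex j) (vertex i.+1))
    (vsub (vertex j.+1) (vertex i.+1)) (vsub (vertex j.+1) (vertex i)).

Definition far (i j : nat) :=
  [&& j %% n != i %% n, j %% n != i.+1 %% n & j.+1 %% n != i %% n]%N.

Lemma farC i j : far i j = far j i.
Proof. by apply/and3P/and3P => -[h1 h2 h3]; split; rewrite eq_sym. Qed.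

Lemma far_not_adjacent i j s t : (i < n)%N -> (j < n)%N -> far i j -> ~ adjacent_at n i j s t.
Proof.
move=> ni nj; rewrite /far (modn_small ni) (modn_small nj) => /and3P[_ h1 h2].
by case=> [] [e _]; [move: h1|move: h2]; rewrite -e eqxx.
Qed.

Lemma vertexE i : (i < n)%N -> vertex i = v i.
Proof. by move=> ni; rewrite /vertex modn_small. Qed.

Let pos_hit u i j := let: a := vsub (v j) (v i) in
  let: e := seg_dir n v i in let: f := seg_dir n v j in
  (0 < det3 a f e) && pos4 (- det3 a e u) (det3 f e u - det3 f a u)
    (det3 f e u + det3 a e u) (det3 f a u).

Let neg_hit u i j := let: a := vsub (v j) (v i) in
  let: e := seg_dir n v i in let: f := seg_dir n v j in
  (det3 a f e < 0) && pos4 (det3 a e u) (det3 f a u - det3 f e u)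
    (- det3 f e u - det3 a e u) (- det3 f a u).

Lemma pair_hitE u i j : (i < n)%N -> (j < n)%N ->
  pair_hit u i j = (pos_hit u i j)%:Z - (neg_hit u i j)%:Z.
Proof.
move=> ni nj; rewrite /pair_hit (vertexE ni) (vertexE nj).
have -> : vsub (v j) (vertex i.+1) = vsub (vsub (v j) (v i)) (seg_dir n v i).
  by apply: pt3_eq => /=; ring.
have -> : vsub (vertex j.+1) (v i) = vadd (vsub (v j) (v i)) (seg_dir n v j).
  by apply: pt3_eq => /=; ring.
have -> : vsub (vertex j.+1) (vertex i.+1)
    = vsub (vadd (vsub (v j) (v i)) (seg_dir n v j)) (seg_dir n v i).
  by apply: pt3_eq => /=; ring.
rewrite cell_hitE /quad_cond.
by congr (_ - Posz (nat_of_bool (_ && pos4 _ _ _ _))); ring.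
Qed.

Lemma proj_meetC u i j s t : proj_meet n v u i j s t -> proj_meet n v u j i t s.
Proof.
case=> hs ht h; split=> //; rewrite /same_proj in h *.
have -> : cross (vsub (seg_pt n v j t) (seg_pt n v i s)) u
   = vscale (-1) (cross (vsub (seg_pt n v i s) (seg_pt n v j t)) u).
  by apply: pt3_eq => /=; ring.
by rewrite h; apply: pt3_eq => /=; ring.
Qed.

Section Diagram.
Variable u : pt3 R.
Hypothesis general : general_position n v u.

Let u_neq0 : u <> vzero R. Proof. by case: general. Qed.

Lemma far_meet i j s t : (i < n)%N -> (j < n)%N -> far i j ->
  proj_meet n v u i j s t ->
  [/\ 0 < s < 1, 0 < t < 1 & det3 (seg_dir n v j) (seg_dir n v i) u != 0].
Proof.
move=> ni nj fij; case: general => _ _ transverse _ m.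
have ne : i <> j by move=> e; move: fij; rewrite /far e eqxx.
case: (transverse i j s t ni nj ne m) => [/(far_not_adjacent ni nj fij)//|[hs ht D0]].
split=> //; have -> : det3 (seg_dir n v j) (seg_dir n v i) u
  = - det3 (seg_dir n v i) (seg_dir n v j) u by rewrite /det3 /dot /=; ring.
by rewrite oppr_eq0.
Qed.

Lemma pos_hitP i j : (i < n)%N -> (j < n)%N -> far i j ->
  (exists s t, [/\ proj_meet n v u i j s t,
     height u (seg_pt n v i s) < height u (seg_pt n v j t) &
     0 < det3 (seg_dir n v j) (seg_dir n v i) u]) <-> pos_hit u i j.
Proof.
move=> ni nj fij; split.
  case=> s [t [m h D0]]; have [s01 t01 _] := far_meet ni nj fij m.
  case: m => _ _ /meeting_values; rewrite -/(seg_pt n v i s) -/(seg_pt n v j t).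
  case=> e1 e2 e3; have uu := dotuu_gt0 u_neq0.
  rewrite /pos_hit /pos4.
  have -> : 0 < det3 (vsub (v j) (v i)) (seg_dir n v j) (seg_dir n v i).
    rewrite -(pmulr_rgt0 _ uu) e3 mulr_gt0 //.
    by move: h; rewrite /height /dot /=; lra.
  by apply/and4P; split; nra.
rewrite /pos_hit; set a := vsub _ _; set e := seg_dir n v i; set f := seg_dir n v j.
set D := det3 f e u => /andP[d0 /and4P[p1 p2 p3 p4]].
(* The first and third conditions add up to [0 < D]. *)
have D0 : 0 < D by lra.
exists (det3 f a u / D), (- det3 a e u / D).
have := meeting_exists (v i) (v j) (lt0r_neq0 D0).
rewrite -/a -/D -/(seg_pt n v i _) -/(seg_pt n v j _) => E; split=> //.
- split.
  + by rewrite /in01 ler_pdivlMr ?ler_pdivrMr //; lra.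
  + by rewrite /in01 ler_pdivlMr ?ler_pdivrMr //; lra.
  + by rewrite /same_proj E; apply: pt3_eq => /=; ring.
- rewrite -subr_lt0 /height.
  have -> p q : dot p u - dot q u = dot (vsub p q) u by rewrite /dot /=; ring.
  rewrite E; have -> l : dot (vscale (- l) u) u = - (l * dot u u) by rewrite /dot /=; ring.
  by rewrite oppr_lt0 mulr_gt0 ?divr_gt0 // dotuu_gt0.
Qed.

Lemma neg_hitP i j : (i < n)%N -> (j < n)%N -> far i j ->
  (exists s t, [/\ proj_meet n v u i j s t,
     height u (seg_pt n v i s) < height u (seg_pt n v j t) &
     det3 (seg_dir n v j) (seg_dir n v i) u < 0]) <-> neg_hit u i j.
Proof.
move=> ni nj fij; split.
  case=> s [t [m h D0]]; have [s01 t01 _] := far_meet ni nj fij m.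
  case: m => _ _ /meeting_values; rewrite -/(seg_pt n v i s) -/(seg_pt n v j t).
  case=> e1 e2 e3; have uu := dotuu_gt0 u_neq0.
  rewrite /neg_hit /pos4.
  have -> : det3 (vsub (v j) (v i)) (seg_dir n v j) (seg_dir n v i) < 0.
    rewrite -(pmulr_rlt0 _ uu) e3 nmulr_llt0 //.
    by move: h; rewrite /height /dot /=; lra.
  by apply/and4P; split; nra.
rewrite /neg_hit; set a := vsub _ _; set e := seg_dir n v i; set f := seg_dir n v j.
set D := det3 f e u => /andP[d0 /and4P[p1 p2 p3 p4]].
have D0 : D < 0 by lra.
exists (det3 f a u / D), (- det3 a e u / D).
have := meeting_exists (v i) (v j) (ltr0_neq0 D0).
rewrite -/a -/D -/(seg_pt n v i _) -/(seg_pt n v j _) => E; split=> //.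
- split.
  + by rewrite /in01 ler_ndivlMr ?ler_ndivrMr //; lra.
  + by rewrite /in01 ler_ndivlMr ?ler_ndivrMr //; lra.
  + by rewrite /same_proj E; apply: pt3_eq => /=; ring.
- rewrite -subr_lt0 /height.
  have -> p q : dot p u - dot q u = dot (vsub p q) u by rewrite /dot /=; ring.
  rewrite E; have -> l : dot (vscale (- l) u) u = - (l * dot u u) by rewrite /dot /=; ring.
  by rewrite oppr_lt0 mulr_gt0 ?dotuu_gt0 // nmulr_rgt0 // invr_lt0.
Qed.

Lemma far_crossing_sign i j : (i < n)%N -> (j < n)%N -> far i j ->
  (asbool (pos_crossing n v u i j))%:Z - (asbool (neg_crossing n v u i j))%:Z
  = pair_hit u i j + pair_hit u j i.
Proof.
move=> ni nj fij; have fji : far j i by rewrite farC.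
have nadj := far_not_adjacent ni nj fij.
have -> : asbool (pos_crossing n v u i j) = pos_hit u i j || pos_hit u j i.
  apply/asboolP/orP => [[s [t [m _ [[h D0]|[h D0]]]]]|[/pos_hitP|/pos_hitP]].
  - by right; apply/pos_hitP => //; exists t, s; split=> //; apply: proj_meetC.
  - by left; apply/pos_hitP => //; exists s, t.
  - by case=> // s [t [m h D0]]; exists s, t; split=> //; right.
  - by case=> // t [s [/proj_meetC m h D0]]; exists s, t; split=> //; left.
have -> : asbool (neg_crossing n v u i j) = neg_hit u i j || neg_hit u j i.
  apply/asboolP/orP => [[s [t [m _ [[h D0]|[h D0]]]]]|[/neg_hitP|/neg_hitP]].
  - by right; apply/neg_hitP => //; exists t, s; split=> //; apply: proj_meetC.
  - by left; apply/neg_hitP => //; exists s, t.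
  - by case=> // s [t [m h D0]]; exists s, t; split=> //; right.
  - by case=> // t [s [/proj_meetC m h D0]]; exists s, t; split=> //; left.
rewrite !pair_hitE //.
have swap e f : det3 (vsub (v i) (v j)) e f = - det3 (vsub (v j) (v i)) e f.
  by rewrite /det3 /dot /=; ring.
have anti a e f : det3 a e f = - det3 e a f by rewrite /det3 /dot /=; ring.
(* The first entry for [(i, j)] and the fourth for [(j, i)] are opposite, so no crossing is counted
   twice. *)
have : ~~ (pos_hit u i j && pos_hit u j i).
  rewrite /pos_hit; apply/negP => /andP[/andP[_ /and4P[h _ _ _]] /andP[_ /and4P[_ _ _]]].
  by rewrite (anti (seg_dir n v i)) swap; lra.
have : ~~ (neg_hit u i j && neg_hit u j i).
  rewrite /neg_hit; apply/negP => /andP[/andP[_ /and4P[h _ _ _]] /andP[_ /and4P[_ _ _]]].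
  by rewrite (anti (seg_dir n v i)) swap; lra.
by case: (pos_hit u i j); case: (pos_hit u j i); case: (neg_hit u i j);
  case: (neg_hit u j i).
Qed.

(** For consecutive edges the vector between the starting points is the earlier edge up to sign. By
    [meeting_values] the parameter on that edge is [1] unless the determinant vanishes; general
    position excludes both. *)
Lemma near_no_crossing i j : (i < n)%N -> (j < n)%N -> i <> j -> ~~ far i j ->
  ~ is_crossing n v u i j.
Proof.
move=> ni nj ne nfar [s [t [m nadj]]].
case: general => _ _ transverse _.
case: (transverse i j s t ni nj ne m) => // -[s01 t01 D0].
case: m => _ _ /meeting_values[e1 e2 _].
move: nfar; rewrite /far (modn_small ni) (modn_small nj).
have -> /= : j != i by apply/eqP => e; apply: ne.
case/nandP; rewrite negbK => /eqP e.
- have E : seg_dir n v i = vsub (v j) (v i) by rewrite /seg_dir e.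
  move: e2 D0; rewrite -E.
  have -> : det3 (seg_dir n v i) (seg_dir n v j) u = - det3 (seg_dir n v j) (seg_dir n v i) u.
    by rewrite /det3 /dot /=; ring.
  by rewrite oppr_eq0 => h /negP; apply; apply/eqP; nra.
- have E : vsub (v j) (v i) = vscale (-1) (seg_dir n v j).
    by rewrite /seg_dir e; apply: pt3_eq => /=; ring.
  move: e1 D0; rewrite E.
  have -> : det3 (seg_dir n v i) (seg_dir n v j) u = - det3 (seg_dir n v j) (seg_dir n v i) u.
    by rewrite /det3 /dot /=; ring.
  have -> : det3 (vscale (-1) (seg_dir n v j)) (seg_dir n v i) u
    = - det3 (seg_dir n v j) (seg_dir n v i) u by rewrite /det3 /dot /=; ring.
  by rewrite oppr_eq0 => h /negP; apply; apply/eqP; nra.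
Qed.

End Diagram.

End Polygon.

(** * Sums over pairs of cyclic indices *)

Section Sums.
Implicit Types (F : nat -> nat -> int) (g : nat -> int).

Lemma sum_unordered_pairs n F : (forall i, F i i = 0) ->
  \sum_(i < n) \sum_(j < n | (i < j)%N) (F i j + F j i) = \sum_(i < n) \sum_(j < n) F i j.
Proof.
move=> F0; under eq_bigr do rewrite big_split /=.
rewrite big_split /= [X in _ + X](exchange_big_dep predT) //= -big_split /=.
apply: eq_bigr => i _; rewrite [RHS](bigID (fun j : 'I_n => (i < j)%N)) /=; congr (_ + _).
rewrite [LHS]big_mkcond [RHS]big_mkcond; apply: eq_bigr => j _ /=.
by rewrite -leqNgt; case: ltngtP => // /val_inj ->; rewrite F0.
Qed.

Lemma sum_shift1 n g : g n = g 0%N -> \sum_(0 <= i < n) g i.+1 = \sum_(0 <= i < n) g i.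
Proof.
case: n => [|n] e; first by rewrite !big_geq.
by rewrite big_nat_recr //= e [RHS]big_nat_recl //= addrC.
Qed.

Lemma sum_shift n g m : (forall i, g (i + n)%N = g i) ->
  \sum_(0 <= i < n) g (m + i)%N = \sum_(0 <= i < n) g i.
Proof.
move=> per; elim: m => [//|m <-]; rewrite -(sum_shift1 (g := fun i => g (m + i)%N)).
  by apply: eq_bigr => i _; rewrite addSnnS.
by rewrite per addn0.
Qed.

(* The boundary of the band [2 <= j - i <= n - 2] of the torus [(Z/n)^2]. *)
Lemma sum_band n F (al be : nat -> nat -> int) : (3 <= n)%N ->
  (forall j, be n (n + j)%N = be 0%N j) ->
  (forall i k, (2 <= k < n.-1)%N -> F i (i + k)%N =
     al i (i + k)%N + be i.+1 (i + k)%N - al i (i + k).+1 - be i (i + k)%N) ->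
  \sum_(0 <= i < n) \sum_(2 <= k < n.-1) F i (i + k)%N =
  \sum_(0 <= i < n) (be i i.+1 + al i i.+2)
  - \sum_(0 <= i < n) (al i (i + n.-1)%N + be i.+1 (i + n.-1)%N).
Proof.
move=> n3 per hF; rewrite exchange_big /=.
(* Up to sign, [f k] sums over the closed staircase between the cells of offsets [k - 1] and [k], so
   the sum over one offset is a difference and telescopes. *)
pose f k := - (\sum_(0 <= i < n) (al i (i + k)%N + be i.+1 (i + k)%N)).
have shift k : \sum_(0 <= i < n) be i.+1 (i + k.+1)%N = \sum_(0 <= i < n) be i (i + k)%N.
  rewrite -(sum_shift1 (g := fun i => be i (i + k)%N)); last by rewrite per add0n.
  by apply: eq_bigr => i _; rewrite addSnnS.
have step k : (2 <= k < n.-1)%N -> \sum_(0 <= i < n) F i (i + k)%N = f k.+1 - f k.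
  move=> hk; rewrite /f opprK addrC [X in _ - X]big_split /= shift -big_split /= -sumrB.
  by apply: eq_bigr => i _; rewrite hF // addnS; ring.
rewrite (eq_big_nat _ _ step) telescope_sumr; last by lia.
rewrite /f opprK addrC; congr (_ - _).
rewrite !big_split /= shift addrC; congr (_ + _); apply: eq_bigr => i _.
  by rewrite addn1.
by rewrite addn2.
Qed.

Lemma norm_sum_le n g : (forall i, `|g i| <= 1) -> `|\sum_(0 <= i < n) g i| <= n%:Z.
Proof.
move=> h; apply: le_trans (ler_norm_sum _ _ _) _.
apply: (@le_trans _ _ (\sum_(0 <= i < n) 1)); first by apply: ler_sum.
by rewrite big_const_nat subn0 iter_addr_0 pmulrn intz.
Qed.

End Sums.

(** * Perturbing a direction *)

Section Generic.
Variable R : realType.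
Implicit Types (a b u w : pt3 R).

Fixpoint horner_val (cs : seq R) (x : R) : R := if cs is c :: cs' then c + x * horner_val cs' x else 0.

(** The first nonzero coefficient dominates just right of zero. The bound [B] strengthens the
    induction: it makes [x] times the tail smaller than a nonzero constant term. *)
Lemma horner_sign cs : exists2 d : R, 0 < d & exists B : R, forall x, 0 < x < d ->
  [/\ `|horner_val cs x| <= B, has (fun c => c != 0) cs -> horner_val cs x != 0 &
      head 0 cs != 0 -> Num.sg (horner_val cs x) = Num.sg (head 0 cs)].
Proof.
elim: cs => [|c cs [d d0 [B IH]]]; first by exists 1; rewrite ?ltr01 //; exists 0 => x _;
  split; rewrite //= ?normr0 ?eqxx.
have [->|c0] := eqVneq c 0.
  exists d => //; exists (d * B) => x hx; have /andP[x0 xd] := hx.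
  have [h1 h2 _] := IH x hx; rewrite /= add0r eqxx; split=> //.
    by rewrite normrM (gtr0_norm x0) ler_pM // ltW.
  by move=> /h2 h; rewrite mulf_neq0 // gt_eqF.
have B1 : 0 < `|B| + 1 by rewrite ltr_wpDl.
pose d' := Num.min d (`|c| / (`|B| + 1)).
exists d'; first by rewrite lt_min d0 divr_gt0 ?normr_gt0.
exists (`|c| + d * B) => x /andP[x0]; rewrite lt_min ltr_pdivlMr // => /andP[xd xc].
have [h1 _ _] := IH x ltac:(by rewrite x0 xd); set h := horner_val cs x in h1 *.
have xh : `|x * h| < `|c|.
  rewrite normrM (gtr0_norm x0); apply: le_lt_trans xc.
  rewrite ler_pM2l //; apply: le_trans h1 _; have := ler_norm B; lra.
have sg : Num.sg (c + x * h) = Num.sg c.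
  move: xh; case: (ltrgtP c 0) c0 => // sc _; rewrite ltr_norml => /andP[l1 l2].
    by rewrite (ltr0_norm sc) in l1 l2; rewrite (ltr0_sg sc) ltr0_sg //; lra.
  by rewrite (gtr0_norm sc) in l1 l2; rewrite (gtr0_sg sc) gtr0_sg //; lra.
rewrite /= -/h; split=> //; last by move=> _; rewrite -sgr_eq0 sg sgr_eq0.
apply: le_trans (ler_normD _ _) _; rewrite lerD2l normrM (gtr0_norm x0).
by rewrite ler_pM // ltW.
Qed.

(** A step along the moment curve: the scalar product with a fixed nonzero vector is a nonzero
    polynomial in [x]. *)
Definition nudge u (x : R) := vadd u (P3 x (x ^+ 2) (x ^+ 3)).

Lemma generic_direction (T : finType) (a : T -> pt3 R) u : exists w, forall i,
  (a i <> vzero R -> dot (a i) w != 0) /\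
  (dot (a i) u != 0 -> Num.sg (dot (a i) w) = Num.sg (dot (a i) u)).
Proof.
pose good x i := (a i <> vzero R -> dot (a i) (nudge u x) != 0) /\
  (dot (a i) u != 0 -> Num.sg (dot (a i) (nudge u x)) = Num.sg (dot (a i) u)).
suff [d d0 h] : exists2 d : R, 0 < d & forall x i, 0 < x < d -> i \in enum T -> good x i.
  by exists (nudge u (d / 2)) => i; apply: h; rewrite ?mem_enum //; lra.
elim: (enum T) => [|i s [d d0 IH]]; first by exists 1.
have [d' d'0 [B h]] := horner_sign [:: dot (a i) u; px (a i); py (a i); pz (a i)].
exists (Num.min d d') => [|x j /andP[x0]]; rewrite lt_min; first by rewrite d0.
move=> /andP[xd xd']; rewrite inE => /orP[/eqP->|js]; last by apply: IH => //; rewrite x0.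
have [_ h1 h2] := h x ltac:(by rewrite x0).
have E : dot (a i) (nudge u x) = horner_val [:: dot (a i) u; px (a i); py (a i); pz (a i)] x.
  by rewrite /dot /=; ring.
rewrite /good E; split=> // ne; apply: h1 => /=.
case: (eqVneq (px (a i)) 0) => [e1|]; last by rewrite !orbT.
case: (eqVneq (py (a i)) 0) => [e2|]; last by rewrite !orbT.
case: (eqVneq (pz (a i)) 0) => [e3|]; last by rewrite !orbT.
by case: ne; apply: pt3_eq.
Qed.

Lemma nonparallel_vector a : exists b, a <> vzero R -> cross a b <> vzero R.
Proof.
have [e|e] := eqVneq (px a) 0; last first.
  by exists (P3 0 1 0) => _ [_ _ h]; move: e; rewrite -h; apply/negP; rewrite negbK; apply/eqP; ring.
have [e'|e'] := eqVneq (py a) 0; last first.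
  by exists (P3 1 0 0) => _ [_ _ h]; move: e'; rewrite -oppr_eq0 -h; apply/negP; rewrite negbK; apply/eqP; ring.
exists (P3 1 0 0) => ne [_ h _]; apply: ne; apply: pt3_eq => //=.
by rewrite -h; ring.
Qed.

(** Both segments have the normal [cross a b], hence the same [m] and [n], whose signs fix the
    direction of passage. As [a + b] is not on both sides of the plane of [u] and [u'], at most one
    segment counts. *)
Lemma merged_edges u u' a b c : c = vadd a b ->
  `|arc_hit u u' a c + arc_hit u u' c b| <= 1.
Proof.
move=> ->; rewrite /arc_hit /arc_cond.
have e x : det3 a (vadd a b) x = det3 a b x by rewrite /det3 /dot /=; ring.
have e' x : det3 (vadd a b) b x = det3 a b x by rewrite /det3 /dot /=; ring.
rewrite !e !e'; set h := det3 u u' (vadd a b).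
case: (ltrgtP h 0) => _; rewrite ?andbF ?andbT /=;
case: (ltrgtP (det3 u u' a) 0) => _; rewrite ?andbF ?andbT /=;
case: (ltrgtP (det3 u u' b) 0) => _; rewrite ?andbF ?andbT /=;
case: (ltrgtP (det3 a b u) 0) => _; rewrite ?andbF ?andbT /=;
by case: (ltrgtP (det3 a b u') 0).
Qed.

End Generic.

(** * Comparing two projections of one knot *)

Section Main.
Variables (R : realType) (n : nat) (v : nat -> pt3 R).
Implicit Types (a b u w : pt3 R).
Hypothesis knot : polygonal_knot n v.

Let n3 : (3 <= n)%N. Proof. by case: knot. Qed.
Let n0 : (0 < n)%N. Proof. exact: leq_trans n3. Qed.

Let r i j := vsub (vertex n v j) (vertex n v i).

Lemma vertexD i : vertex n v (i + n) = vertex n v i.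
Proof. by rewrite /vertex modnDr. Qed.

Lemma vertex_mod i : vertex n v (i %% n) = vertex n v i.
Proof. by rewrite /vertex modn_mod. Qed.

Lemma vertexS_mod i : vertex n v (i %% n).+1 = vertex n v i.+1.
Proof. by rewrite /vertex -addn1 modnDml addn1. Qed.

Lemma far_mod i j : far n i j = far n (i %% n) (j %% n).
Proof. by rewrite /far !modn_mod -![(_ %% n).+1]addn1 !modnDml !addn1. Qed.

Lemma pair_hit_mod u i j : pair_hit n v u i j = pair_hit n v u (i %% n) (j %% n).
Proof. by rewrite /pair_hit !vertex_mod !vertexS_mod. Qed.

(** The vector is the difference of points at parameters [t] and [s] of edges [j] and [i]; its
    vanishing would be a self-intersection of the knot. *)
Lemma far_disjoint i j s t : far n i j -> in01 s -> in01 t ->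
  vadd (r i j) (vadd (vscale s (vsub (r i.+1 j) (r i j))) (vscale t (vsub (r i j.+1) (r i j))))
  <> vzero R.
Proof.
move=> fij hs ht e; rewrite far_mod in fij.
have [ni nj] := (ltn_pmod i n0, ltn_pmod j n0).
apply: (far_not_adjacent (R := R) (s := s) (t := t) ni nj fij).
case: knot => _ _; apply => //.
  by move=> ij; move: fij; rewrite /far ij eqxx.
have seg k x : seg_pt n v (k %% n) x =
    vadd (vertex n v k) (vscale x (vsub (vertex n v k.+1) (vertex n v k))).
  by rewrite -vertexS_mod.
have -> : seg_pt n v (i %% n) s = vsub (seg_pt n v (j %% n) t) (vzero R).
  by rewrite -e !seg; apply: pt3_eq => /=; ring.
by apply: pt3_eq => /=; ring.
Qed.

Definition pair_generic u u' :=
  (forall i j k l, in_general u u' (r i j) (r k l)) /\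
  (forall i j, r i j <> vzero R -> det3 u u' (r i j) != 0).

Lemma pair_boundary u u' i j : pair_generic u u' -> far n i j ->
  pair_hit n v u i j - pair_hit n v u' i j =
  arc_hit u u' (r i j) (r i.+1 j) + arc_hit u u' (r i.+1 j) (r i.+1 j.+1)
  - arc_hit u u' (r i j.+1) (r i.+1 j.+1) - arc_hit u u' (r i j) (r i j.+1).
Proof.
move=> [gen gen0] fij; have miss := far_disjoint fij.
have i0 : in01 (0 : R) by rewrite /in01 lexx ler01.
have i1 : in01 (1 : R) by rewrite /in01 lexx ler01.
have sides : vadd (r i j) (r i.+1 j.+1) = vadd (r i.+1 j) (r i j.+1).
  by apply: pt3_eq => /=; ring.
have ne0 p s t : in01 s -> in01 t ->
    p = vadd (r i j) (vadd (vscale s (vsub (r i.+1 j) (r i j))) (vscale t (vsub (r i j.+1) (r i j)))) ->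
    p <> vzero R.
  by move=> hs ht ->; apply: miss.
(* Reversing two sides gives opposite sides opposite signs, so that neighbouring cells cancel along
   their common side. *)
rewrite -(arc_anti u u' (r i j.+1) (r i.+1 j.+1)) -(arc_anti u u' (r i j) (r i j.+1)).
apply: cell_boundary => //; try exact: gen; apply: gen0.
- by apply: (ne0 _ 0 0) => //; apply: pt3_eq => /=; ring.
- by apply: (ne0 _ 1 0) => //; apply: pt3_eq => /=; ring.
- by apply: (ne0 _ 1 1) => //; apply: pt3_eq => /=; ring.
- by apply: (ne0 _ 0 1) => //; apply: pt3_eq => /=; ring.
Qed.

Definition sign_stable u w := forall i j k l,
  det3 (r i j) (r k l) u != 0 -> Num.sg (det3 (r i j) (r k l) w) = Num.sg (det3 (r i j) (r k l) u).

Lemma pair_hit_stable u w i j : general_position n v u -> sign_stable u w ->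
  (i < n)%N -> (j < n)%N -> far n i j -> pair_hit n v w i j = pair_hit n v u i j.
Proof.
move=> gp stable ni nj fij; rewrite /pair_hit /cell_hit -!/(r _ _).
pose a := vsub (v j) (v i); pose e := seg_dir n v i; pose f := seg_dir n v j.
have ea : r i j = a by rewrite /r (vertexE v ni) (vertexE v nj).
have eb : r i.+1 j = vsub a e.
  by rewrite /r (vertexE v nj) /a; apply: pt3_eq => /=; ring.
have ed : r i j.+1 = vadd a f.
  by rewrite /r (vertexE v ni) /a; apply: pt3_eq => /=; ring.
have ec : r i.+1 j.+1 = vsub (vadd a f) e.
  by rewrite /r /a; apply: pt3_eq => /=; ring.
have m1E : det3 (r i j) (r i.+1 j) u = - det3 a e u.
  by rewrite ea eb /det3 /dot /=; ring.
have m4E : det3 (r i j.+1) (r i j) u = det3 f a u.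
  by rewrite ea ed /det3 /dot /=; ring.
have DE : det3 (r i j) (r i.+1 j) u + det3 (r i.+1 j.+1) (r i j.+1) u = det3 f e u.
  by rewrite ea eb ec ed /det3 /dot /=; ring.
apply: quad_cond_stable; try exact: stable.
- by rewrite ea eb ec ed /det3 /dot /=; ring.
- rewrite DE m1E m4E => h1 h4 D0.
  have -> : det3 (r i j) (r i.+1 j) (r i.+1 j.+1) = det3 a f e.
    by rewrite ea eb ec /det3 /dot /=; ring.
  have uu : 0 < dot u u by apply: dotuu_gt0; case: gp.
  (* With the other three determinants zero, Cramer's rule makes [det3 a f e] times the nonzero
     vector [u] vanish. *)
  have := cramer a e f u; rewrite D0 h4 -[det3 a e u]opprK h1 => E.
  apply: (mulIf (lt0r_neq0 uu)); rewrite mul0r.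
  have -> : det3 a f e * dot u u = dot (vscale (det3 a f e) u) u by rewrite /dot /=; ring.
  by rewrite -E /dot /=; ring.
rewrite DE m1E m4E => D0 hs ht.
suff m : proj_meet n v u i j (det3 f a u / det3 f e u) (- det3 a e u / det3 f e u).
  by have [] := far_meet gp ni nj fij m.
split=> //; rewrite /same_proj.
have := meeting_exists (v i) (v j) D0.
rewrite -/a -/(seg_pt n v i _) -/(seg_pt n v j _) => ->.
by apply: pt3_eq => /=; ring.
Qed.

Definition total_hits u : int :=
  \sum_(i < n) \sum_(j < n) (if far n i j then pair_hit n v u i j else 0).

Lemma writhe_total u : general_position n v u -> writhe n v u = total_hits u.
Proof.
move=> gp; pose F i j : int := if far n i j then pair_hit n v u i j else 0.
rewrite /total_hits -(@sum_unordered_pairs n F); last first.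
  by move=> i; rewrite /F /far eqxx.
apply: eq_bigr => i _; apply: eq_bigr => j ij; rewrite /F (farC n j).
have [fij|nfar] := boolP (far n i j); first exact: far_crossing_sign.
have nocross : ~ is_crossing n v u i j.
  by apply: near_no_crossing => // e; rewrite e ltnn in ij.
rewrite !asboolF //.
  by move=> [s [t [m nadj _]]]; apply: nocross; exists s, t.
by move=> [s [t [m nadj _]]]; apply: nocross; exists s, t.
Qed.

Lemma total_stable u w : general_position n v u -> sign_stable u w ->
  total_hits w = total_hits u.
Proof.
move=> gp stable; apply: eq_bigr => i _; apply: eq_bigr => j _.
by case: ifP => // fij; apply: pair_hit_stable.
Qed.

Lemma far_band i k : (k < n)%N -> far n i (i + k) = (2 <= k < n.-1)%N.
Proof.
move=> kn; rewrite /far -addnS.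
rewrite -[X in _ == X %[mod _]]addn0 eqn_modDl.
rewrite -[i.+1]addn1 eqn_modDl -[X in (i + k.+1)%N != X %[mod _]]addn0 eqn_modDl.
rewrite mod0n (modn_small kn) modn_small; last by lia.
have [->|kn1] := eqVneq k n.-1; first by rewrite prednK // modnn; lia.
by rewrite modn_small; lia.
Qed.

(** By periodicity [j] may run over [i + k] with [0 <= k < n]; the offsets [0], [1] and [n - 1]
    belong to the edge itself and its neighbours. *)
Lemma total_band u : total_hits u =
  \sum_(0 <= i < n) \sum_(2 <= k < n.-1) pair_hit n v u i (i + k)%N.
Proof.
rewrite /total_hits big_mkord; apply: eq_bigr => i _.
pose g j : int := if far n i j then pair_hit n v u i j else 0.
rewrite -(big_mkord xpredT g) -(@sum_shift n g i); last first.
  by move=> j; rewrite /g far_mod pair_hit_mod modnDr -far_mod -pair_hit_mod.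
rewrite /g (@big_cat_nat _ _ _ 2) //=; last exact: ltnW.
rewrite (@big_cat_nat _ _ _ n.-1 2) //=; try by lia.
rewrite big1_seq ?add0r; last first.
  move=> k; rewrite mem_index_iota => /andP[_ hk].
  by rewrite far_band ?ifF //; lia.
rewrite [X in _ + X]big1_seq ?addr0; last first.
  move=> k; rewrite mem_index_iota => /andP[_ hk].
  by rewrite far_band ?ifF //; lia.
by apply: eq_big_nat => k hk; rewrite far_band ?hk //; lia.
Qed.

Lemma total_hits_diff u u' : pair_generic u u' ->
  `|total_hits u - total_hits u'| <= (2 * n)%:Z.
Proof.
move=> gen; rewrite !total_band -sumrB; under eq_bigr do rewrite -sumrB.
rewrite (@sum_band n (fun i j => pair_hit n v u i j - pair_hit n v u' i j)
  (fun i j => arc_hit u u' (r i j) (r i.+1 j))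
  (fun i j => arc_hit u u' (r i j) (r i j.+1))) //; last first.
- by move=> i k hk; apply: pair_boundary => //; rewrite far_band //; lia.
- move=> j; have e0 : vertex n v n = vertex n v 0 := vertexD 0.
  by rewrite /r e0 -addnS ![(n + _)%N]addnC !vertexD.
apply: le_trans (ler_normB _ _) _; rewrite mul2n -addnn PoszD lerD //.
- apply: norm_sum_le => i; apply: merged_edges.
  by apply: pt3_eq => /=; ring.
(* The offset [n - 1] acts as [-1]: these are the opposites of the edges [i - 1] and [i] and of
   their sum. *)
- apply: norm_sum_le => i; apply: merged_edges.
  have -> : r i.+1 (i + n.-1).+1 = r i.+1 i.
    by rewrite /r -addnS prednK // vertexD.
  by apply: pt3_eq => /=; ring.
Qed.

(** [w] is chosen first, off all planes spanned by two differences and, through the auxiliary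
    vectors [b], not parallel to any nonzero difference. Then [cross (r i j) w] is nonzero, and [w']
    can avoid its orthogonal plane. *)
Lemma generic_pair u u' : exists w w',
  [/\ pair_generic w w', sign_stable u w & sign_stable u' w'].
Proof.
have [b hb] := choice (fun i : 'I_n * 'I_n => nonparallel_vector (r i.1 i.2)).
pose S := (('I_n * 'I_n) * ('I_n * 'I_n) + 'I_n * 'I_n)%type.
pose normals (c : 'I_n * 'I_n -> pt3 R) (s : S) := match s with
  | inl (i, j) => cross (r i.1 i.2) (r j.1 j.2)
  | inr i => cross (r i.1 i.2) (c i) end.
have [w hw] := generic_direction (normals b) u.
have [w' hw'] := generic_direction (normals (fun=> w)) u'.
pose o k : 'I_n := Ordinal (ltn_pmod k n0).
have rE i j : r i j = r (o i) (o j) by rewrite /r /= !vertex_mod.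
exists w, w'; split.
- split=> [i j k l|i j].
    rewrite (rE i) (rE k) => ne; split.
      exact: (hw (inl ((o i, o j), (o k, o l)))).1.
    exact: (hw' (inl ((o i, o j), (o k, o l)))).1.
  rewrite (rE i) => ne; have -> a : det3 w w' a = dot (cross a w) w'.
    by rewrite /det3 /dot /=; ring.
  apply: (hw' (inr (o i, o j))).1 => e.
  have := (hw (inr (o i, o j))).1 (hb (o i, o j) ne) => /= /negP; apply.
  have -> : dot (cross (r (o i) (o j)) (b (o i, o j))) w
      = - dot (cross (r (o i) (o j)) w) (b (o i, o j)) by rewrite /dot /=; ring.
  by apply/eqP; move: e => /= ->; rewrite /dot /=; ring.
- by move=> i j k l; rewrite (rE i) (rE k); apply: (hw (inl ((o i, o j), (o k, o l)))).2.
- by move=> i j k l; rewrite (rE i) (rE k); apply: (hw' (inl ((o i, o j), (o k, o l)))).2.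
Qed.

Lemma writhe_diff u u' : general_position n v u -> general_position n v u' ->
  `|writhe n v u - writhe n v u'| <= (2 * n)%:Z.
Proof.
move=> gp gp'; have [w [w' [gen st st']]] := generic_pair u u'.
rewrite (writhe_total gp) (writhe_total gp') -(total_stable gp st) -(total_stable gp' st').
exact: total_hits_diff.
Qed.

Lemma writhe_le_crossings u : `|writhe n v u| <= (crossings n v u)%:Z.
Proof.
rewrite /writhe /crossings -natz natr_sum; apply: le_trans (ler_norm_sum _ _ _) _.
apply: ler_sum => i _; rewrite natr_sum; apply: le_trans (ler_norm_sum _ _ _) _.
apply: ler_sum => j _; rewrite natz.
case: (asboolP (pos_crossing n v u i j)) => [[s [t [m nadj _]]]|_];
case: (asboolP (neg_crossing n v u i j)) => [[s' [t' [m' nadj' _]]]|_] //.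
- by rewrite asboolT //; exists s, t.
- by rewrite asboolT //; exists s', t'.
Qed.

End Main.

Theorem theorem3p3 (R : realType) (n : nat) (v : nat -> pt3 R) (u u' : pt3 R) :
  polygonal_knot n v -> general_position n v u -> general_position n v u' ->
  ((`|writhe n v u|%:R - 3 * n%:R) / 16 <= (crossings n v u')%:R :> rat).
Proof.
move=> knot gp gp'.
have := writhe_diff knot gp gp'; have := writhe_le_crossings n v u'.
set W := writhe n v u; set W' := writhe n v u'; set c := crossings n v u'.
(* This yields [|W| - 3 n <= c - n <= 16 c]. *)
move=> h1 h2; have : (`|W| <= 2 * n + c)%N by lia.
rewrite -(ler_nat rat) natrD natrM => h; have : 0 <= c%:R :> rat by []; have : 0 <= n%:R :> rat by [].
lra.
Qed.
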